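(* Let $D$ be a $3$-anti-circulant digraph. If $D$ contains no induced subdigraph that is a blocking odd cycle, then $D$ is BE-diperfect.
   Context: All digraphs are finite, without loops and without multiple arcs (a pair of opposite arcs $uv$, $vu$, called a digon, is allowed). $u\to v$ means $uv$ is an arc. A path is a sequence of distinct vertices $v_1v_2\dots v_k$ with $v_iv_{i+1}$ an arc for all $i$; it starts at $v_1$ and ends at $v_k$. A stable set is a set of pairwise non-adjacent vertices. A path partition of $D$ is a collection of vertex-disjoint paths covering $V(D)$. For a stable set $S$, an $S_{BE}$-path partition is a path partition in which every path contains exactly one vertex of $S$ and every vertex of $S$ is the first or the last vertex of its path. $D$ satisfies the BE-property if for every maximum stable set $S$ of $D$ there is an $S_{BE}$-path partition; $D$ is BE-diperfect if every induced subdigraph of $D$ satisfies the BE-property. An anti-$P_4$ is a set of four distinct vertices $v_1,v_2,v_3,v_4$ with $v_1\to v_2$, $v_3\to v_2$, $v_3\to v_4$ (written $v_1\to v_2\leftarrow v_3\to v_4$). $D$ is $3$-anti-circulant if for every anti-$P_4$ $v_1\to v_2\leftarrow v_3\to v_4$ in $D$ we have $v_4\to v_1$. A blocking odd cycle is a digraph $C$ whose underlying simple graph is a cycle $x_1x_2\dots x_{2k+1}x_1$ with $k\ge 1$, such that $x_1$ is a source (no in-neighbours in $C$) and $x_2$ is a sink (no out-neighbours in $C$). *)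

(* Defs.v *)
From mathcomp Require Import all_boot.

Set Implicit Arguments.
Unset Strict Implicit.
Unset Printing Implicit Defensive.

(* A digraph is an irreflexive relation e on a finType T, with e u v meaning   *)
(* u -> v. Symmetric pairs (digons) are allowed.                              *)

Section Digraph.

Variables (T : finType) (e : rel T).

Definition adjacent : rel T := [rel u v | e u v || e v u].

Definition dipath (p : seq T) : bool :=
  if p is x :: q then path e x q && uniq p else false.

(* [uniq (flatten P)] expresses vertex-disjointness: paths are nonempty, so it *)
(* also forbids listing a path twice.                                         *)
Definition path_partition (P : seq (seq T)) : Prop :=
  [/\ all dipath P, uniq (flatten P) & forall x, x \in flatten P].

Definition stable (S : {set T}) : bool :=
  [forall u in S, forall v in S, ~~ adjacent u v].

Definition maximum_stable (S : {set T}) : Prop :=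
  stable S /\ forall S' : {set T}, stable S' -> #|S'| <= #|S|.

(* Since x \in p, p is nonempty and the default value x of head and last is  *)
(* never used.                                                                *)
Definition BE_path_partition (S : {set T}) (P : seq (seq T)) : Prop :=
  [/\ path_partition P,
      forall p, p \in P -> #|[set x in S | x \in p]| = 1
    & forall p x, p \in P -> x \in S -> x \in p ->
        x = head x p \/ x = last x p].

Definition BE_property : Prop :=
  forall S : {set T}, maximum_stable S -> exists P, BE_path_partition S P.

(* The four vertices may have further arcs between them.                      *)
Definition anti_P4 (v1 v2 v3 v4 : T) : bool :=
  uniq [:: v1; v2; v3; v4] && [&& e v1 v2, e v3 v2 & e v3 v4].

Definition anti_circulant3 : Prop :=
  forall v1 v2 v3 v4 : T, anti_P4 v1 v2 v3 v4 -> e v4 v1.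

Definition source (x : T) : Prop := forall y, ~~ e y x.
Definition sink (x : T) : Prop := forall y, ~~ e x y.

(* The whole digraph is a blocking odd cycle; x is indexed from 0, and ordS   *)
(* is the cyclic successor on 'I_n.                                           *)
Definition blocking_odd_cycle : Prop :=
  exists (k : nat) (x : 'I_k.*2.+1 -> T),
    [/\ 1 <= k,
        bijective x,
        forall i j, adjacent (x i) (x j) = (j == ordS i) || (i == ordS j),
        source (x ord0)
      & sink (x (ordS ord0))].

Definition induced (A : {set T}) : rel {x : T | x \in A} :=
  [rel u v | e (val u) (val v)].

End Digraph.

Definition BE_diperfect (T : finType) (e : rel T) : Prop :=
  forall A : {set T}, BE_property (@induced T e A).

(* Main.v *)
Require Import Defs.
From mathcomp Require Import all_boot.
From mathcomp Require Import zify.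

(* In a 3-anti-circulant digraph the only induced blocking odd cycles are the   *)
(* transitive triangles, so every triangle c -> v -> p, c -> p has a further    *)
(* arc. Let S be a maximum stable set of D and B = D \ S.                       *)
(*                                                                              *)
(* By induction on D one may assume that no transitive triple c -> v -> p,      *)
(* c -> p has both c and p in B. If v -> c, every other in-neighbour of p is an *)
(* in-neighbour of c, so c can be inserted before p in a path partition of      *)
(* D - c; the case p -> v is dual. If p -> c, take a maximal clique K           *)
(* containing c, v and p: unless D splits into K and D - K with additive        *)
(* stability numbers, some stable set of size |S| avoids K, and this is         *)
(* incompatible with 3-anti-circularity.                                        *)
(*                                                                              *)
(* Contracting an arc y -> p inside B (keeping the in-arcs of y and the         *)
(* out-arcs of p) then does not increase the stability number: if a stable set  *)
(* Z of the quotient contains the new vertex, replacing it by y or by p gives a *)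
(* stable set, unless Z contains an out-neighbour w of y and an in-neighbour v  *)
(* of p; but w = v is a transitive triple, and otherwise v -> p <- y -> w       *)
(* forces w -> v. The argument needs v and w to be uncontracted vertices, so    *)
(* one path is extended at both ends until it is isolated in the quotient of B  *)
(* before the next one is started. When no arc is left in B, the paths form a   *)
(* stable set, and Hall's theorem attaches them to distinct vertices of S.      *)

Set Implicit Arguments.
Unset Strict Implicit.
Unset Printing Implicit Defensive.

(** * Hall's marriage theorem *)

Section Marriage.

Variables (U : finType) (r : rel U).

Definition neighbours (Y A : {set U}) := [set y in Y | [exists x in A, r x y]].

Lemma neighboursP (Y A : {set U}) y :
  reflect (y \in Y /\ exists2 x, x \in A & r x y) (y \in neighbours Y A).
Proof.
by rewrite inE; apply: (iffP andP) => -[yY /exists_inP h]; split.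
Qed.

(** Induction on the size of [X]. If a nonempty proper subset [A] is tight, [A] is matched into its
    neighbourhood, and Hall's condition survives for [X] minus [A] and [Y] minus that neighbourhood.
    Otherwise every nonempty proper subset has a spare neighbour, so any edge x0 y0 can be put in
    the matching and removed. *)
Lemma marriage (X Y : {set U}) :
    (forall A : {set U}, A \subset X -> #|A| <= #|neighbours Y A|) ->
  exists2 m : U -> U, {in X &, injective m}
    & forall x, x \in X -> (m x \in Y) /\ r x (m x).
Proof.
have [n] := ubnP #|X|; elim: n X Y => // n IHn X Y ltXn hallX.
have [-> | [x0 x0X]] := set_0Vmem X.
  by exists id => [x y|x]; rewrite inE.
case: (boolP [exists A : {set U},
    [&& A \proper X, A != set0 & #|neighbours Y A| <= #|A|]]).
  case/existsP=> A /and3P[prAX A_n0 tightA].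
  have sAX := proper_sub prAX.
  have ltAX := proper_card prAX.
  have A_gt0 : 0 < #|A| by rewrite card_gt0.
  have [||m1 inj1 m1P] := IHn A Y; first by lia.
    by move=> C sCA; apply: hallX; apply: subset_trans sAX.
  have cXA := cardsD X A.
  have [||m2 inj2 m2P] := IHn (X :\: A) (Y :\: neighbours Y A).
  - by move: cXA; rewrite (setIidPr sAX); lia.
  - move=> C /subsetDP[sCX dCA].
    have /hallX: A :|: C \subset X by rewrite subUset sAX.
    rewrite cardsU disjoint_setI0 1?disjoint_sym // cards0 subn0 => le1.
    suff /subset_leq_card le2 : neighbours Y (A :|: C) \subset
        neighbours Y A :|: neighbours (Y :\: neighbours Y A) C.
      by rewrite cardsU in le2; lia.
    apply/subsetP=> y /neighboursP[yY [x]]; rewrite in_setU => xAC rxy.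
    rewrite in_setU; case: (boolP (y \in neighbours Y A)) => //= yNA.
    apply/neighboursP; split; first by rewrite in_setD yNA.
    case/orP: xAC => [xA|xC]; last by exists x.
    by case/negP: yNA; apply/neighboursP; split=> //; exists x.
  have m1N x : x \in A -> m1 x \in neighbours Y A.
    move=> xA; have [m1Y rx] := m1P x xA.
    by apply/neighboursP; split=> //; exists x.
  have m2N x : x \in X -> x \notin A -> m2 x \in Y :\: neighbours Y A.
    by move=> xX xA; case: (m2P x) => //; rewrite in_setD xA.
  exists (fun x => if x \in A then m1 x else m2 x) => [x y xX yX|x xX].
    case: ifPn => xA; case: ifPn => yA.
    - exact: inj1.
    - by have := m2N y yX yA; rewrite in_setD => /andP[/negP nA _] exy;
        case: nA; rewrite -exy m1N.
    - by have := m2N x xX xA; rewrite in_setD => /andP[/negP nA _] exy;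
        case: nA; rewrite exy m1N.
    - by apply: inj2; rewrite in_setD ?xA ?yA.
  case: ifPn => xA; first exact: m1P.
  have [|] := m2P x; first by rewrite in_setD xA.
  by rewrite in_setD => /andP[].
rewrite negb_exists => /forallP slack.
have /hallX : [set x0] \subset X by rewrite sub1set.
rewrite cards1 card_gt0 => /set0Pn[y0 /neighboursP[y0Y [x]]].
rewrite inE => /eqP-> r00.
have [||m inj mP] := IHn (X :\ x0) (Y :\ y0).
- by move: ltXn; rewrite (cardsD1 x0 X) x0X; lia.
- move=> C sCX; have [->|C_n0] := eqVneq C set0; first by rewrite cards0.
  have prC : C \proper X by apply: sub_proper_trans (properD1 x0X).
  have := slack C; rewrite prC C_n0 /= -ltnNge => lt1.
  suff : neighbours Y C :\ y0 \subset neighbours (Y :\ y0) C.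
    move/subset_leq_card; have := cardsD1 y0 (neighbours Y C); lia.
  apply/subsetP=> y; rewrite in_setD1 => /andP[ny /neighboursP[yY hx]].
  by apply/neighboursP; rewrite in_setD1 ny.
exists (fun x => if x == x0 then y0 else m x) => [x' y xX yX|x' xX].
  have mN z : z \in X -> z != x0 -> m z != y0.
    by move=> zX nz; have [|] := mP z; rewrite in_setD1 ?nz // => /andP[].
  case: eqVneq => [->|nx]; case: eqVneq => [->|ny] // exy.
  - by have := mN y yX ny; rewrite exy eqxx.
  - by have := mN x' xX nx; rewrite exy eqxx.
  - by apply: inj; rewrite // in_setD1 ?nx ?ny.
case: eqVneq => [->|nx] //.
by have [|] := mP x'; rewrite in_setD1 ?nx // => /andP[].
Qed.

End Marriage.

(** * Stable sets and BE-partitions relative to a vertex set *)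

Section Digraphs.

Variables (T : finType) (e : rel T).
Hypothesis e_irr : irreflexive e.
Hypothesis e_ac3 : anti_circulant3 e.
Implicit Types (D S W Z K : {set T}) (f : T -> seq T).

Lemma stableP S :
  reflect {in S &, forall x y, ~~ e x y} (stable e S).
Proof.
apply: (iffP forall_inP) => [h x y xS yS | h x xS].
  by have /forall_inP/(_ y yS) := h x xS; rewrite /= negb_or => /andP[].
by apply/forall_inP=> y yS /=; rewrite negb_or !h.
Qed.

Lemma arc_neq x y : e x y -> x != y.
Proof. by apply: contraTneq => ->; rewrite e_irr. Qed.

Lemma anti_P4_closed a b c d : a != c -> a != d -> b != d ->
  e a b -> e c b -> e c d -> e d a.
Proof.
move=> ac ad bd ab cb cd; apply: (e_ac3 (v2 := b) (v3 := c)).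
rewrite /anti_P4 /= !inE !negb_or ab cb cd ac ad bd (arc_neq ab) (arc_neq cd).
by rewrite eq_sym (arc_neq cb).
Qed.

(** Induced subdigraphs are represented by vertex subsets [D] of the fixed type [T], so that
    induction on [D] stays within one type. *)
Definition maximum_stable_in D S :=
  [/\ stable e S, S \subset D
    & forall Z, Z \subset D -> stable e Z -> #|Z| <= #|S|].

(** Distinctness of the vertices comes from [uniq (flatten P)] in [BE_partition_of]; with it,
    [count] is the number of vertices of [S] on the path. *)
Definition BE_path S (p : seq T) :=
  if p is x :: q then
    [&& path e x q, count (mem S) p == 1 & (x \in S) || (last x q \in S)]
  else false.

Definition BE_partition_of D S (P : seq (seq T)) :=
  [/\ all (BE_path S) P, uniq (flatten P) & flatten P =i D].

(** * Path systems and the quotient digraphs obtained by contracting them *)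

Lemma uniq_flatten_map (I : eqType) (g : I -> seq T) (s : seq I) :
    uniq s -> {in s, forall i, uniq (g i)} ->
    {in s &, forall i j x, x \in g i -> x \in g j -> i = j} ->
  uniq (flatten [seq g i | i <- s]).
Proof.
elim: s => //= i s IHs /andP[is_ us] ug dg; rewrite cat_uniq ug ?mem_head //=.
rewrite IHs // ?andbT => [|j js|j k js ks]; first last.
- by apply: dg; rewrite inE ?js ?ks orbT.
- by apply: ug; rewrite inE js orbT.
apply/hasPn=> x /flatten_mapP[j js xj]; apply/negP=> xi.
by case/negP: is_; rewrite (dg i j _ _ x) // inE ?eqxx ?js ?orbT.
Qed.

(* A system of disjoint paths [y :: f y], for y in W; contracting each of them  *)
(* to its first vertex gives a digraph on W with arcs [e (tip f y) y'].          *)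
Definition tip f y := last y (f y).

Definition independent f Z :=
  {in Z &, forall y y', y != y' -> ~~ e (tip f y) y'}.

Definition isolated f W y :=
  [forall w in W, (w != y) ==> ~~ e (tip f y) w && ~~ e (tip f w) y].

(** This is the invariant of the contraction process. The vertices of [S] stay uncontracted, and by
    [ps_max] no independent set of the quotient is larger than [S], which is what Hall's condition
    will come from. *)
Record path_system D S W f : Prop := PathSystem {
  ps_path : {in W, forall y, path e y (f y)};
  ps_uniq : {in W, forall y, uniq (y :: f y)};
  ps_disj : {in W &, forall y y' x, x \in y :: f y -> x \in y' :: f y' -> y = y'};
  ps_cover : forall x, (x \in D) <-> (exists2 y, y \in W & x \in y :: f y);
  ps_sub : S \subset W;
  ps_triv : {in S, forall s, f s = [::]};
  ps_max : forall Z, Z \subset W -> independent f Z -> #|Z| <= #|S| }.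

Lemma tip_mem f y : tip f y \in y :: f y.
Proof. exact: mem_last. Qed.

(** Hall's condition follows from [ps_max]: for a set [A] of paths outside [S] with neighbourhood
    [N] in [S], the union of [A] and [S :\: N] is independent in the quotient, so |A| + |S| - |N| <=
    |S|. *)
Lemma attach D S W f : stable e S -> path_system D S W f ->
    independent f (W :\: S) -> exists P, BE_partition_of D S P.
Proof.
move=> /stableP stS [fP fU fD fC sSW fS maxS] indW.
(* The two disjuncts are the two ways to attach [s]: in front of the path of [y], or behind it. *)
pose r y s := e s y || e (tip f y) s.
have tipS s : s \in S -> tip f s = s by rewrite /tip => /fS->.
have [|m m_inj mP] := @marriage T r (W :\: S) S.
  move=> A /subsetDP[sAW dAS]; set N := neighbours r S A.
  have sNS : N \subset S by apply/subsetP=> s /neighboursP[].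
  have NN s a : s \in S -> s \notin N -> a \in A -> ~~ r a s.
    by move=> sS + aA; apply: contra => ras; apply/neighboursP; split=> //; exists a.
  have /maxS : A :|: (S :\: N) \subset W.
    by rewrite subUset sAW (subset_trans (subsetDl _ _)).
  have -> : #|A :|: (S :\: N)| = #|A| + #|S :\: N|.
    rewrite cardsU disjoint_setI0 ?cards0 ?subn0 //.
    by apply: disjointWr dAS; apply: subsetDl.
  have cSN := cardsD S N; rewrite (setIidPr sNS) in cSN.
  have := subset_leq_card sNS => leNS hmax.
  suff /hmax : independent f (A :|: (S :\: N)) by lia.
  move=> y y'; rewrite !in_setU !in_setD => hy hy' nyy'.
  case/orP: hy => [yA|/andP[yN yS]]; case/orP: hy' => [y'A|/andP[y'N y'S]].
  - apply: indW => //; rewrite in_setD.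
    + by rewrite (subsetP sAW) // (disjointFr dAS).
    + by rewrite (subsetP sAW) // (disjointFr dAS).
  - by have := NN _ _ y'S y'N yA; rewrite /r negb_or => /andP[].
  - by have := NN _ _ yS yN y'A; rewrite /r negb_or (tipS y) // => /andP[].
  - by rewrite tipS // stS.
pose g s := if [pick y in W :\: S | m y == s] is Some y then
    if e s y then s :: y :: f y else rcons (y :: f y) s else [:: s].
have gP s : s \in S ->
    (g s = [:: s] /\ forall y, y \in W :\: S -> m y != s) \/
    exists y, [/\ y \in W :\: S, m y = s &
      (e s y /\ g s = s :: y :: f y) \/
      (e (tip f y) s /\ g s = rcons (y :: f y) s)].
  move=> sS; rewrite /g; case: pickP => [y /andP[yW /eqP my]|no]; last first.
    by left; split=> // y yW; have := no y; rewrite yW /= => ->.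
  right; exists y; split=> //; case: ifP => [esy|nesy]; first by left.
  by right; split=> //; have [_] := mP y yW; rewrite /r my nesy.
have gM s x : s \in S -> (x \in g s) -> x = s \/
    exists2 y, y \in W :\: S & m y = s /\ x \in y :: f y.
  move=> sS; case: (gP s sS) => [[-> _]|[y [yW my gs]]].
    by rewrite inE => /eqP; left.
  case: gs => -[_ ->]; rewrite ?mem_rcons in_cons => /orP[/eqP|]; try by left.
  - by move=> xy; right; exists y.
  - by move=> xy; right; exists y.
have fNS y x : y \in W :\: S -> x \in y :: f y -> x \notin S.
  rewrite in_setD => /andP[yS yW] xy; apply: contra yS => xS.
  by rewrite (fD y x yW (subsetP sSW x xS) x) // mem_head.
have cS y : y \in W :\: S -> count (mem S) (y :: f y) = 0.
  move=> yW; apply/eqP; rewrite eqn0Ngt -has_count; apply/hasPn=> x xy.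
  exact: fNS xy.
exists [seq g s | s <- enum S]; split.
- apply/allP=> _ /mapP[s sS ->]; rewrite mem_enum in sS.
  case: (gP s sS) => [[-> _]|[y [yW my [[esy ->]|[ets ->]]]]].
  + by rewrite /= sS.
  + have /setDP[yW' _] := yW.
    by have := cS y yW; rewrite /= esy sS fP //= => ->.
  + have /setDP[yW' _] := yW.
    have := cS y yW; rewrite /= rcons_path fP //= ets -cats1 count_cat /= sS.
    by rewrite last_cat /= sS orbT !addn0 addnA => ->.
- apply: uniq_flatten_map; first exact: enum_uniq.
  + move=> s; rewrite mem_enum => sS.
    case: (gP s sS) => [[-> _]|[y [yW my gs]]] //.
    have /setDP[yW' _] := yW.
    have sy : s \notin y :: f y by apply/negP=> /(fNS _ _ yW); rewrite sS.
    case: gs => -[_ ->]; first by rewrite cons_uniq sy; apply: fU.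
    by rewrite rcons_uniq sy; apply: fU.
  + move=> s s'; rewrite !mem_enum => sS s'S x /(gM _ _ sS)[->|[y yW [my xy]]].
      case/(gM _ _ s'S) => [//|[y yW [_ /(fNS _ _ yW)]]]; by rewrite sS.
    case/(gM _ _ s'S) => [xs'|[y' y'W [my' xy']]].
      by have := fNS _ _ yW xy; rewrite xs' s'S.
    have /setDP[yW' _] := yW; have /setDP[y'W' _] := y'W.
    by rewrite -my -my' (fD y y' yW' y'W' x).
- move=> x; apply/flatten_mapP/idP => [[s]|/fC[y yW xy]].
    rewrite mem_enum => sS /(gM _ _ sS) xs; apply/fC.
    case: xs => [->|[y /setDP[yW _] [_ xy]]].
      by exists s; rewrite ?mem_head // (subsetP sSW).
    by exists y.
  have [yS|yS] := boolP (y \in S).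
    exists y; rewrite ?mem_enum //; move: xy; rewrite fS // inE => /eqP->.
    by case: (gP y yS) => [[-> _]|[z [_ _ [[_ ->]|[_ ->]]]]];
      rewrite ?mem_rcons mem_head.
  have yWS : y \in W :\: S by rewrite in_setD yS.
  have [myS _] := mP y yWS; exists (m y); rewrite ?mem_enum //.
  case: (gP _ myS) => [[_ /(_ y yWS)]|[z [zW mz gz]]]; first by rewrite eqxx.
  have zy : z = y by apply: m_inj.
  by case: gz => -[_ ->]; rewrite ?mem_rcons in_cons zy xy orbT.
Qed.

(** The middle vertex [v] ranges over all of [D], because in [contract] it comes from an independent
    set that may meet [S]. *)
Definition transitive_free D S := forall c v p, c \in D :\: S -> v \in D ->
  p \in D :\: S -> e c v -> e v p -> ~~ e c p.

Lemma contract D S W f y p : transitive_free D S -> path_system D S W f ->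
    y \in W :\: S -> p \in W :\: S -> y != p -> e (tip f y) p ->
    (forall x, x \in W :\: S -> x != y -> x != p ->
       f x = [::] \/ isolated f (W :\: S) x) ->
  path_system D S (W :\ p) (fun x => if x == y then f y ++ p :: f p else f x).
Proof.
move=> tfD [fP fU fD fC sSW fS maxS] /setDP[yW yS] /setDP[pW pS] nyp eyp fs.
set f' := fun x : T => _.
have f'y : f' y = f y ++ p :: f p by rewrite /f' eqxx.
have f'n x : x != y -> f' x = f x by rewrite /f' => /negPf->.
have tip'y : tip f' y = tip f p by rewrite /tip f'y last_cat.
have tip'n x : x != y -> tip f' x = tip f x by move=> ?; rewrite /tip f'n.
have tipNS x : x \in W -> x \notin S -> tip f x \in D :\: S.
  move=> xW xS; rewrite in_setD; apply/andP; split.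
    apply: contra xS => txS; rewrite (fD x _ xW (subsetP sSW _ txS) (tip f x)) //.
      exact: tip_mem.
    exact: mem_head.
  by apply/fC; exists x => //; apply: tip_mem.
have WD x : x \in W -> x \in D by move=> xW; apply/fC; exists x; rewrite ?mem_head.
have mem' x z : z \in x :: f' x =
    (z \in x :: f x) || (x == y) && (z \in p :: f p).
  by rewrite /f'; case: eqP => [->|_]; rewrite ?orbF // -cat_cons mem_cat.
split.
- move=> x /setD1P[_ xW]; have [->|nx] := eqVneq x y; last by rewrite f'n ?fP.
  by rewrite f'y cat_path fP //= fP // andbT.
- move=> x /setD1P[_ xW]; have [->|nx] := eqVneq x y; last by rewrite f'n ?fU.
  rewrite f'y -cat_cons cat_uniq !fU // andbT; apply/hasPn=> z zp.
  by apply: contra nyp => zy; rewrite (fD y p _ _ z).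
- move=> x x' /setD1P[nxp xW] /setD1P[nx'p x'W] z; rewrite !mem'.
  case/orP=> [zx|/andP[/eqP-> zp]]; case/orP=> [zx'|/andP[/eqP-> zp']] //.
  + exact: (fD x x' xW x'W z).
  + by case/eqP: nxp; apply: (fD x p xW pW z).
  + by case/eqP: nx'p; apply: (fD x' p x'W pW z).
- move=> z; rewrite fC; split=> -[x].
    move=> xW zx; have [xp|nxp] := eqVneq x p.
      by exists y; rewrite ?in_setD1 ?nyp // mem' eqxx -xp zx orbT.
    by exists x; rewrite ?in_setD1 ?nxp // mem' zx.
  move=> /setD1P[_ xW]; rewrite mem' => /orP[zx|/andP[_ zp]]; first by exists x.
  by exists p.
- by apply/subsetP=> s sS; rewrite in_setD1 (subsetP sSW) // andbT;
    apply: contraNneq pS => <-.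
- by move=> s sS; rewrite f'n ?fS //; apply: contraNneq yS => <-.
move=> Z sZ' indZ.
have sZ : Z \subset W by apply: subset_trans sZ' (subsetDl _ _).
have pZ : p \notin Z by apply/negP=> /(subsetP sZ'); rewrite !inE eqxx.
have [yZ|yZ] := boolP (y \in Z); last first.
  apply: maxS => // x x' xZ x'Z nxx'; rewrite -tip'n ?indZ //.
  by apply: contraNneq yZ => <-.
(* Without an arc from the old tip of [y] into [Z], the set [Z] is already independent for [f]. *)
have [/exists_inP[w /setD1P[nwy wZ] eyw]|noy] :=
    boolP [exists w in Z :\ y, e (tip f y) w]; last first.
  apply: maxS => // x x' xZ x'Z nxx'; have [xy|nxy] := eqVneq x y.
    apply: contra noy => ex; apply/exists_inP; exists x'; last by rewrite -xy.
    by rewrite in_setD1 x'Z andbT -xy eq_sym.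
  by rewrite -tip'n // indZ.
(* Without an arc from a tip of [Z] to [p], exchanging [y] for [p] gives a set of the same size that
   is independent for [f]. *)
have [/exists_inP[v /setD1P[nvy vZ] evp]|nop] :=
    boolP [exists v in Z :\ y, e (tip f v) p]; last first.
  have -> : #|Z| = #|p |: Z :\ y|.
    by rewrite cardsU1 !inE (negPf pZ) andbF /= (cardsD1 y Z) yZ.
  apply: maxS.
    by rewrite subUset sub1set pW (subset_trans (subsetDl _ _)).
  move=> x x'; rewrite !inE => /orP[/eqP->|/andP[nxy xZ]] /orP[/eqP->|/andP[nx'y x'Z]].
  - by rewrite eqxx.
  - by move=> _; rewrite -tip'y indZ // eq_sym.
  - move=> _; apply: contra nop => ex; apply/exists_inP.
    by exists x; rewrite ?in_setD1 ?nxy.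
  - by move=> nxx'; rewrite -tip'n ?indZ.
have wW := subsetP sZ w wZ; have vW := subsetP sZ v vZ.
have nwp : w != p by apply: contraNneq pZ => <-.
have nvp : v != p by apply: contraNneq pZ => <-.
(* [v] is joined to [p], and [w] to [y], in the quotient. Neither is isolated, so [fs], or [ps_triv]
   inside [S], makes their paths single vertices. *)
have vtriv : tip f v = v.
  rewrite /tip; have [/fS->//|vS] := boolP (v \in S).
  have [|//|//|->//|/forall_inP/(_ p)] := fs v; first by rewrite in_setD vS.
  by rewrite in_setD pS eq_sym nvp evp => /(_ pW).
have wtriv : tip f w = w.
  rewrite /tip; have [/fS->//|wS] := boolP (w \in S).
  have [|//|//|->//|/forall_inP/(_ y)] := fs w; first by rewrite in_setD wS.
  by rewrite in_setD yS eq_sym nwy eyw andbF => /(_ yW).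
rewrite vtriv in evp.
have [wv|nwv] := eqVneq w v.
  by move: (tfD (tip f y) v p); rewrite eyp tipNS // WD // in_setD pS WD // -{1}wv eyw evp;
    move/(_ isT isT isT isT isT).
have ewv : e w v.
  apply: (anti_P4_closed (a := v) (b := p) (c := tip f y)) => //.
  - by apply: contra nvy => /eqP vt; rewrite (fD v y _ _ v) ?mem_head // vt tip_mem.
  - by rewrite eq_sym.
  - by rewrite eq_sym.
by have := indZ w v wZ vZ nwv; rewrite tip'n // wtriv ewv.
Qed.

(** Arcs between paths outside [S] are contracted until none is left, and then [attach] applies. The
    invariant is that at most one path is [bad], that is, nontrivial and not isolated; contracting
    an arc at that path ensures the hypothesis of [contract] on all the others. *)
Lemma BE_partition_of_transitive_free D S : maximum_stable_in D S ->
  transitive_free D S -> exists P, BE_partition_of D S P.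
Proof.
move=> [stS sSD maxS] tfD.
pose bad f W x := [&& x \in W :\: S, f x != [::] & ~~ isolated f (W :\: S) x].
suff main n W f : #|W| < n -> path_system D S W f ->
    {in bad f W &, forall x x', x = x'} -> exists P, BE_partition_of D S P.
  apply: (main #|D|.+1 D (fun _ => [::])) => //; last first.
    by move=> x x' /and3P[_ /eqP].
  split=> //.
  - by move=> x x' _ _ z; rewrite !inE => /eqP-> /eqP.
  - move=> x; split=> [xD|[y yD]].
      by exists x; rewrite ?mem_head.
    by rewrite inE => /eqP->.
  - move=> Z sZD indZ; apply: maxS => //.
    apply/stableP=> x y xZ yZ; have [->|nxy] := eqVneq x y.
      by rewrite e_irr.
    exact: (indZ x y).
elim: n W f => // n IHn W f ltWn psW uniq_bad; have [_ _ _ _ _ _ _] := psW.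
have [indW|] := boolP [forall y in W :\: S, forall p in W :\: S,
    (y != p) ==> ~~ e (tip f y) p].
  apply: (attach stS psW) => y p yW pW nyp.
  by move/forall_inP: indW => /(_ y yW)/forall_inP/(_ p pW); rewrite nyp.
rewrite negb_forall_in => /exists_inP[y0 y0W].
rewrite negb_forall_in => /exists_inP[p0 p0W].
rewrite negb_imply negbK => /andP[nyp0 eyp0].
have [y [p [yW pW nyp eyp fs]]] : exists y p, [/\ y \in W :\: S, p \in W :\: S,
    y != p, e (tip f y) p & forall x, x \in W :\: S -> x != y -> x != p ->
       f x = [::] \/ isolated f (W :\: S) x].
  (* A bad path is extended at whichever end has an arc; if there is none, the arc from [y0] to [p0]
     serves. *)
  case: (pickP (bad f W)) => [c bad_c|no_bad]; last first.
    exists y0, p0; split=> // x xW _ _; have := no_bad x; rewrite /bad xW /=.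
    by case: (f x) => [|z q] /=; [left | move/negbFE; right].
  have others x : x \in W :\: S -> x != c -> f x = [::] \/ isolated f (W :\: S) x.
    move=> xW nxc; have [->|fx] := eqVneq (f x) [::]; first by left.
    right; apply/negPn; apply: contraNN nxc => nis; apply/eqP.
    by apply: uniq_bad; rewrite // -topredE /= /bad xW fx.
  have /and3P[cW _] := bad_c.
  rewrite negb_forall_in => /exists_inP[w wW].
  rewrite negb_imply negb_and !negbK => /andP[nwc /orP[ecw|ewc]].
    by exists c, w; split=> // [|x xW nxc _]; [rewrite eq_sym | apply: others].
  by exists w, c; split=> // x xW _; apply: others.
apply: IHn (contract tfD psW yW pW nyp eyp fs) _.
  have /setDP[pW' _] := pW.
  by move: ltWn; rewrite (cardsD1 p W) pW'.
set f' := fun x : T => _.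
(* A path isolated before the contraction remains so: the merged path is entered at [y] and left at
   the old tip of [p]. *)
have onlyy x : bad f' (W :\ p) x -> x = y.
  case/and3P=> /setDP[/setD1P[nxp xW] xS] + nis; apply: contraTeq => nxy.
  rewrite negbK /f' (negPf nxy); apply/eqP.
  have xWS : x \in W :\: S by rewrite in_setD xS.
  have [//|/forall_inP is_x] := fs x xWS nxy nxp.
  case/negP: nis; apply/forall_inP=> w /setDP[/setD1P[nwp wW] wS].
  apply/implyP=> nwx.
  have := is_x w; rewrite in_setD wS nwx => /(_ wW)/=/andP[exw ewx].
  rewrite {1}/tip /f' (negPf nxy) exw /tip /=.
  case: ifPn => [/eqP wy|_] //=.
  rewrite last_cat /=; have := is_x p pW; rewrite eq_sym nxp /=.
  by case/andP.
by move=> x x' /onlyy-> /onlyy->.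
Qed.


(** * Inserting a vertex into a path partition *)

(** As [c] lies outside [S], whenever it becomes an end of the path the vertex of [S] must sit at
    the opposite end; this is the content of the last two premises. *)
Lemma BE_path_insert S c r1 r2 : c \notin S -> BE_path S (r1 ++ r2) ->
    (forall r x, r1 = rcons r x -> e x c) -> (forall y r, r2 = y :: r -> e c y) ->
    (r1 = [::] -> last c r2 \in S) -> (r2 = [::] -> head c r1 \in S) ->
  BE_path S (r1 ++ c :: r2).
Proof.
move=> cS; case: r1 => [|x r1] /=.
  case: r2 => [//|y r2] /= /and3P[py cy _] _ /(_ y r2 erefl) -> /(_ erefl) ly _.
  by rewrite py (negPf cS) cy ly.
rewrite !cat_path !count_cat !last_cat => /and3P[/andP[px pr2] cx sx].
move/(_ (belast x r1) (last x r1)); rewrite -lastI => /(_ erefl) exc ec _ sr.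
rewrite px /= exc (negPf cS) add0n cx /=.
by case: r2 {cx} pr2 sx ec sr => [|y r2] /=;
  [move=> _ _ _ /(_ erefl)-> | move=> /andP[_ ->] -> /(_ y r2 erefl)->].
Qed.

Lemma BE_partition_insert D S P c r1 r2 : c \in D ->
    BE_partition_of (D :\ c) S P -> r1 ++ r2 \in P ->
    BE_path S (r1 ++ c :: r2) -> exists P', BE_partition_of D S P'.
Proof.
move=> cD [+ + + /path.splitPr def_P]; case: P / def_P => P1 P2.
rewrite all_cat /= => /and3P[BE1 _ BE2] uP fP BEc.
have pP : perm_eq (flatten (P1 ++ (r1 ++ c :: r2) :: P2))
    (c :: flatten (P1 ++ (r1 ++ r2) :: P2)).
  rewrite !flatten_cat /= -!catA perm_sym -cat1s.
  by rewrite perm_catCA perm_cat2l perm_catCA.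
exists (P1 ++ (r1 ++ c :: r2) :: P2); split.
- by rewrite all_cat /= BE1 BEc.
- by rewrite (perm_uniq pP) /= uP fP !inE eqxx.
- by move=> x; rewrite (perm_mem pP) inE fP !inE; case: eqVneq => [->|].
Qed.

Lemma BE_path_arc S r1 x y r2 : BE_path S (r1 ++ x :: y :: r2) -> e x y.
Proof.
case: r1 => [|z r1] /=; first by case/and3P=> /andP[].
by rewrite cat_path => /and3P[/and3P[_ _ /andP[]]].
Qed.

(** The predecessor of [p] on its path is also an in-neighbour of [c], so [c] fits between them. If
    [p] starts its path, then, [p] being outside [S], the vertex of [S] is the last one, and [c] may
    become the first. *)
Lemma insert_before D S P c p : c \in D :\: S -> p \in D :\: S -> e c p ->
    {in D, forall z, z != c -> e z p -> e z c} ->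
  BE_partition_of (D :\ c) S P -> exists P', BE_partition_of D S P'.
Proof.
move=> /setDP[cD cS] /setDP[pD pS] ecp hz hP; have [BE uP fP] := hP.
have /flatten_mapP/=[r rP] : p \in flatten [seq id r | r <- P].
  by rewrite map_id fP in_setD1 pD eq_sym arc_neq.
case/path.splitPr def_r: r / => [r1 r2]; rewrite def_r in rP.
have BEr := allP BE _ rP.
apply: (BE_partition_insert cD hP rP).
apply: BE_path_insert => [//|//|r' x r1x|y r' [<- _] //|r1n|//].
  have xP : x \in D :\ c.
    rewrite -fP; apply/flattenP; exists (r1 ++ p :: r2) => //.
    by rewrite r1x mem_cat mem_rcons mem_head.
  have /setD1P[nxc xD] := xP; apply: hz => //.
  by apply: (@BE_path_arc S r' x p r2); rewrite -cat_rcons -r1x.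
by move: BEr; rewrite r1n /= (negPf pS) => /and3P[].
Qed.

Lemma insert_after D S P c p : c \in D :\: S -> p \in D :\: S -> e c p ->
    {in D, forall z, z != p -> e c z -> e p z} ->
  BE_partition_of (D :\ p) S P -> exists P', BE_partition_of D S P'.
Proof.
move=> /setDP[cD cS] /setDP[pD pS] ecp hz hP; have [BE uP fP] := hP.
have /flatten_mapP/=[r rP] : c \in flatten [seq id r | r <- P].
  by rewrite map_id fP in_setD1 cD arc_neq.
case/path.splitPr def_r: r / => [r1 r2]; rewrite def_r in rP.
have BEr := allP BE _ rP; rewrite -cat_rcons in rP.
apply: (BE_partition_insert pD hP rP); apply: BE_path_insert => //.
- by rewrite cat_rcons.
- by move=> r' x /rcons_inj[_ <-].
- move=> y r' r2y; have yP : y \in D :\ p.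
    rewrite -fP; apply/flattenP; exists (rcons r1 c ++ r2) => //.
    by rewrite r2y mem_cat mem_head orbT.
  have /setD1P[nyp yD] := yP; apply: hz => //.
  by apply: (@BE_path_arc S r1 c y r'); rewrite -r2y.
- by case: (r1).
- move=> r2n; move: BEr; rewrite r2n; case: (r1) => [|x r'] /=.
    by rewrite (negPf cS).
  by rewrite last_cat /= (negPf cS) orbF => /and3P[].
Qed.

(** The insertion takes place on the side of [p] away from an end lying in [S]. If the head is in
    [S], [c] goes before the first vertex after [p] that it dominates, or at the end: all vertices
    passed on the way dominate [c]. The other side is symmetric. *)
Lemma insert_universal D S P c p : c \in D :\: S -> p \in D :\: S ->
    e c p -> e p c -> {in D, forall z, z != c -> e c z || e z c} ->
  BE_partition_of (D :\ c) S P -> exists P', BE_partition_of D S P'.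
Proof.
move=> /setDP[cD cS] /setDP[pD pS] ecp epc hz hP; have [BE uP fP] := hP.
have /flatten_mapP/=[r rP] : p \in flatten [seq id r | r <- P].
  by rewrite map_id fP in_setD1 pD eq_sym arc_neq.
have rD z : z \in r -> e c z || e z c.
  move=> zr; have : z \in D :\ c by rewrite -fP; apply/flattenP; exists r.
  by case/setD1P=> nzc zD; apply: hz.
case/path.splitPr def_r: r / => [r1 r2]; rewrite def_r in rP rD.
have BEr := allP BE _ rP.
have fwd b q : e q c -> {in b, forall z, e c z || e z c} -> exists b1 b2,
    [/\ b = b1 ++ b2, e (last q b1) c & forall y b', b2 = y :: b' -> e c y].
  elim: b q => [|y b IHb] q eqc hb; first by exists [::], [::].
  have [ecy|necy] := boolP (e c y).
    by exists [::], (y :: b); split=> // y' b' [<-].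
  have eyc : e y c by move: (hb y (mem_head _ _)); rewrite (negPf necy).
  have [|b1 [b2 [-> eb1 eb2]]] := IHb y eyc; last by exists (y :: b1), b2.
  by move=> z zb; apply: hb; rewrite inE zb orbT.
have bwd b q : e c q -> {in b, forall z, e c z || e z c} -> exists b1 b2,
    [/\ b = b1 ++ b2, e c (head q b2) & forall b' y, b1 = rcons b' y -> e y c].
  elim/last_ind: b q => [|b y IHb] q ecq hb.
    by exists [::], [::]; split=> // -[].
  have [eyc|neyc] := boolP (e y c).
    exists (rcons b y), [::]; rewrite cats0.
    by split=> // b' y' /rcons_inj[_ <-].
  have ecy : e c y.
    by have := hb y; rewrite mem_rcons mem_head (negPf neyc) orbF => ->.
  have [|b1 [b2 [-> eb2 eb1]]] := IHb y ecy.
    by move=> z zb; apply: hb; rewrite mem_rcons inE zb orbT.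
  by exists b1, (rcons b2 y); rewrite -rcons_cat; split=> //; case: (b2) eb2.
have [hS|hS] := boolP (head p r1 \in S).
  have [|b1 [b2 [def_r2 eb1 eb2]]] := fwd r2 p epc.
    by move=> z zr; apply: rD; rewrite mem_cat inE zr !orbT.
  have rE : r1 ++ p :: r2 = (r1 ++ p :: b1) ++ b2 by rewrite def_r2 -catA.
  rewrite rE in rP BEr; apply: (BE_partition_insert cD hP rP).
  apply: BE_path_insert => [//|//|r' x|//|/(congr1 size)|_].
  - by move/(congr1 (last c)); rewrite last_cat last_rcons /= => <-.
  - by rewrite size_cat addnS.
  - by move: hS; case: (r1) => //=; rewrite (negPf pS).
have [|b1 [b2 [def_r1 eb2 eb1]]] := bwd r1 p ecp.
  by move=> z zr; apply: rD; rewrite mem_cat zr.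
have rE : r1 ++ p :: r2 = b1 ++ (b2 ++ p :: r2) by rewrite def_r1 -catA.
have lS : last p r2 \in S.
  by move: BEr hS; case: (r1) => [|x r'] /=;
    rewrite ?last_cat => /and3P[_ _] /orP[->|].
rewrite rE in rP BEr; apply: (BE_partition_insert cD hP rP).
apply: BE_path_insert => [//|//|//|y r'|_|/(congr1 size)].
- by case: (b2) eb2 => [|x b'] /= ? [<-].
- by rewrite last_cat.
- by rewrite size_cat addnS.
Qed.

Lemma BE_partition_union D1 D2 S P1 P2 : [disjoint D1 & D2] ->
    BE_partition_of D1 (S :&: D1) P1 -> BE_partition_of D2 (S :&: D2) P2 ->
  BE_partition_of (D1 :|: D2) S (P1 ++ P2).
Proof.
have BE_mono D P : BE_partition_of D (S :&: D) P -> all (BE_path S) P.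
  case=> BE _ fP; apply/allP=> r rP; have := allP BE r rP.
  have rS x : x \in r -> (x \in S :&: D) = (x \in S).
    by move=> xr; rewrite in_setI -fP andbC; case: flattenP => // -[]; exists r.
  case: r rP rS => // x r rP rS /and3P[pr cr sr]; apply/and3P; split=> //.
    have <- // : count (mem (S :&: D)) (x :: r) = count (mem S) (x :: r).
    by apply: eq_in_count => z /rS.
  by rewrite -!rS ?mem_head ?mem_last.
move=> dD h1 h2; have [_ u1 f1] := h1; have [_ u2 f2] := h2; split.
- by rewrite all_cat !(BE_mono _ _ h1, BE_mono _ _ h2).
- rewrite flatten_cat cat_uniq u1 u2 andbT; apply/hasPn=> x.
  by rewrite !f2 f1 => xD; rewrite (disjointFl dD).
- by move=> x; rewrite flatten_cat mem_cat f1 f2 in_setU.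
Qed.

(** * Cliques and the elimination of transitive triples *)

Definition clique K :=
  [forall x in K, forall y in K, (x != y) ==> adjacent e x y].

Lemma cliqueP K :
  reflect {in K &, forall x y, x != y -> adjacent e x y} (clique K).
Proof.
apply: (iffP forall_inP) => [h x y xK yK | h x xK].
  by have /forall_inP/(_ y yK)/implyP := h x xK.
by apply/forall_inP=> y yK; apply/implyP/h.
Qed.

Lemma adjacentE x y : adjacent e x y = e x y || e y x.
Proof. by []. Qed.

Lemma adjacentC x y : adjacent e x y = adjacent e y x.
Proof. exact: orbC. Qed.

Lemma stable_adjacent Z x y : stable e Z -> x \in Z -> y \in Z -> ~~ adjacent e x y.
Proof. by move=> /stableP stZ xZ yZ; rewrite adjacentE negb_or !stZ. Qed.

Lemma stable_clique_card Z K : stable e Z -> clique K -> Z \subset K -> #|Z| <= 1.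
Proof.
move=> stZ /cliqueP cK /subsetP sZK; apply/card_le1_eqP=> x y xZ yZ.
by apply: contraTeq (stable_adjacent stZ xZ yZ) => ?; rewrite negbK cK ?sZK 1?eq_sym.
Qed.

Lemma stable_setU1 Z x : stable e Z -> {in Z, forall z, ~~ adjacent e x z} ->
  stable e (x |: Z).
Proof.
move=> /stableP stZ hx; apply/stableP=> y z.
have hx' w : w \in Z -> ~~ e x w /\ ~~ e w x.
  by move/hx; rewrite adjacentE negb_or => /andP.
move=> /setU1P[->|yZ] /setU1P[->|zZ].
- by rewrite e_irr.
- by case: (hx' z zZ).
- by case: (hx' y yZ).
- exact: stZ.
Qed.

(** For z, w distinct and outside {c, v, p}, 3-anti-circularity gives the chains c -> z => z -> v =>
    p -> z and z -> p => v -> z => z -> c ([R1] to [R4]), and z -> c with p -> w forces w -> z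
    ([R5]). Applied to neighbours in [Z] of [c], [v] and [p], these rules end in an outright
    contradiction, such as an arc inside [Z], or produce a vertex of [Z] adjacent to all three. That
    vertex has a non-neighbour k in [K], but either direction of an arc between k and [c] (or [p])
    forces an arc between k and that vertex. *)
Lemma no_escaping_stable_set Z K c v p : stable e Z -> clique K ->
    [disjoint Z & K] -> c \in K -> v \in K -> p \in K ->
    {in K, forall x, exists2 z, z \in Z & adjacent e x z} ->
    {in Z, forall z, exists2 k, k \in K & ~~ adjacent e k z} ->
  e c v -> e v p -> e c p -> e p c -> False.
Proof.
move=> stZ /cliqueP cK dZK cin vin pin domK escZ ecv evp ecp epc.
have ncv := arc_neq ecv; have nvp := arc_neq evp; have ncp := arc_neq ecp.
have nvc := ncv; have npv := nvp; have npc := ncp.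
rewrite eq_sym in nvc; rewrite eq_sym in npv; rewrite eq_sym in npc.
pose out x := [&& x != c, x != v & x != p].
have ZK z k : z \in Z -> k \in K -> (z != k) && (k != z).
  move=> zZ kK; rewrite [k == z]eq_sym andbb.
  by apply: contraTneq kK => <-; rewrite (disjointFr dZK).
have outZ z : z \in Z -> out z.
  by move=> zZ; rewrite /out; have /andP[-> _] := ZK z c zZ cin;
    have /andP[-> _] := ZK z v zZ vin; have /andP[-> _] := ZK z p zZ pin.
have outE x : out x -> [/\ [/\ x != c, x != v & x != p] & [/\ c != x, v != x & p != x]].
  by case/and3P=> h1 h2 h3; rewrite !(eq_sym _ x).
have R1 z : out z -> e c z -> e z v.
  by case/outE=> -[? ? ?] [? ? ?] ecz; apply: (anti_P4_closed (a := v) (b := p) (c := c)).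
have R2 z : out z -> e z v -> e p z.
  by case/outE=> -[? ? ?] [? ? ?] ezv; apply: (anti_P4_closed (a := z) (b := v) (c := c)).
have R3 z : out z -> e z p -> e v z.
  by case/outE=> -[? ? ?] [? ? ?] ezp; apply: (anti_P4_closed (a := z) (b := p) (c := c)).
have R4 z : out z -> e v z -> e z c.
  by case/outE=> -[? ? ?] [? ? ?] evz; apply: (anti_P4_closed (a := c) (b := p) (c := v)).
have R5 z w : out z -> out w -> z != w -> e z c -> e p w -> e w z.
  move=> /outE[[? ? ?] [? ? ?]] /outE[[? ? ?] [? ? ?]] nzw ezc epw.
  by apply: (anti_P4_closed (a := z) (b := c) (c := p)).
have escape z : z \in Z -> adjacent e c z -> adjacent e v z -> adjacent e p z ->
    exists k, [/\ k \in K, out k, ~~ e k z & ~~ e z k].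
  move=> zZ cz vz pz; have [k kK nkz] := escZ z zZ; exists k.
  move: (nkz); rewrite adjacentE negb_or => /andP[nekz nezk].
  by split=> //; apply/and3P; split; apply: contraNneq nkz => ->.
have adjK k x : k \in K -> x \in K -> out k -> (x = c \/ x = p) -> e x k || e k x.
  move=> kK xK /and3P[k1 k2 k3] xE; apply: (cK x k) => //.
  by case: xE => ->; rewrite eq_sym.
have both z : z \in Z -> e z c -> e p z -> adjacent e v z -> False.
  move=> zZ ezc epz vz; have oz := outZ z zZ.
  have [||k [kK ok nkz nzk]] := escape z zZ _ vz; rewrite ?adjacentE ?ezc ?epz ?orbT //.
  have /andP[nzk' nkz'] := ZK z k zZ kK.
  case/orP: (adjK k c kK cin ok (or_introl erefl)) => [eck|ekc].
    by case/negP: nkz; apply: R5 => //; apply/(R2 _ ok)/(R1 _ ok).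
  by case/negP: nzk; apply: R5.
have [z zZ vz] := domK v vin; have oz := outZ z zZ.
have [z1 z1Z cz1] := domK c cin; have o1 := outZ z1 z1Z.
have [z2 z2Z pz2] := domK p pin; have o2 := outZ z2 z2Z.
have stE x y : x \in Z -> y \in Z -> e x y -> False.
  by move/stableP: stZ => stZ xZ yZ; apply/negP/stZ.
have [epz|nepz] := boolP (e p z).
  have [ez1c|nez1c] := boolP (e z1 c).
    have [zz1|nzz1] := eqVneq z1 z; last by apply: (stE z z1) => //; apply: R5.
    by apply: (both z) => //; rewrite -zz1.
  have ecz1 : e c z1 by move: cz1; rewrite adjacentE (negPf nez1c) orbF.
  have ez1v := R1 _ o1 ecz1; have epz1 := R2 _ o1 ez1v.
  have [|||k [kK ok nkz nzk]] := escape z1 z1Z; rewrite ?adjacentE ?ecz1 ?ez1v ?epz1 ?orbT //.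
  have /andP[nz1k nkz1] := ZK z1 k z1Z kK.
  case/orP: (adjK k c kK cin ok (or_introl erefl)) => [eck|ekc].
    case/negP: nkz; have [_ [? ? ?]] := outE _ ok; have [[? ? ?] _] := outE _ o1.
    by apply: (anti_P4_closed (a := z1) (b := v) (c := c)).
  by case/negP: nzk; apply: R5.
have ezc : e z c.
  case/orP: vz => [|ezv]; first exact: R4.
  by rewrite R2 in nepz.
have [epz2|nepz2] := boolP (e p z2).
  have [zz2|nzz2] := eqVneq z z2; last by apply: (stE z2 z) => //; apply: R5.
  by rewrite zz2 epz2 in nepz.
have ez2p : e z2 p by move: pz2; rewrite adjacentE (negPf nepz2).
have evz2 := R3 _ o2 ez2p; have ez2c := R4 _ o2 evz2.
have [|||k [kK ok nkz nzk]] := escape z2 z2Z; rewrite ?adjacentE ?ez2p ?evz2 ?ez2c ?orbT //.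
have /andP[nz2k nkz2] := ZK z2 k z2Z kK.
case/orP: (adjK k p kK pin ok (or_intror erefl)) => [epk|ekp].
  by case/negP: nkz; apply: R5.
case/negP: nzk; have [[? ? ?] _] := outE _ ok; have [_ [? ? ?]] := outE _ o2.
by apply: (anti_P4_closed (a := k) (b := p) (c := v)).
Qed.

Hypothesis noTT3 : forall x y z, e x y -> e y z -> e x z ->
  [|| e y x, e z y | e z x].

Definition BE_below D := forall D' S, #|D'| < #|D| ->
  maximum_stable_in D' S -> exists P, BE_partition_of D' S P.

Lemma maximum_stable_setD1 D S c : c \in D :\: S ->
  maximum_stable_in D S -> maximum_stable_in (D :\ c) S.
Proof.
move=> /setDP[cD cS] [stS sSD maxS]; split=> //.
  by apply/subsetP=> x xS; rewrite in_setD1 (subsetP sSD) // andbT;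
    apply: contraNneq cS => <-.
by move=> Z sZ; apply: maxS; apply: subset_trans sZ (subsetDl _ _).
Qed.

(** If [S] misses [K], then [S] is the required [Z]. Otherwise [S] has exactly one vertex in [K];
    when no [Z] exists, [S :\: K] is maximum in [D :\: K], and the partitions given by induction on
    [K] and on [D :\: K] are united. *)
Lemma clique_reduction D S K : maximum_stable_in D S -> BE_below D ->
    clique K -> K \proper D -> K != set0 ->
  (exists P, BE_partition_of D S P) \/
  exists Z : {set T}, [/\ Z \subset D :\: K, stable e Z & #|S| <= #|Z|].
Proof.
move=> [stS sSD maxS] IH cK prK K_n0; have sKD := proper_sub prK.
have [/pred0P dSK|] := boolP [disjoint S & K].
  right; exists S; split=> //; apply/subsetP=> x xS; rewrite in_setD (subsetP sSD) // andbT.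
  by have := dSK x; rewrite /= xS /= => ->.
rewrite -setI_eq0 => /set0Pn[s /setIP[sS sK]].
have [/existsP[Z /and3P[? ? ?]]|noZ] := boolP [exists Z : {set T},
    [&& Z \subset D :\: K, stable e Z & #|S| <= #|Z|]]; first by right; exists Z.
left; have stSI A : stable e (S :&: A).
  by apply/stableP=> x y /setIP[xS _] /setIP[yS _]; move/stableP: stS => ->.
have leSK : #|S :&: K| <= 1.
  by apply: stable_clique_card (subsetIr _ _).
have cSK := cardsID K S; have ltK := proper_card prK.
have S_K : S :&: (D :\: K) = S :\: K.
  by apply/setP=> x; rewrite !inE; case xS: (x \in S);
    rewrite ?andbF //= (subsetP sSD) // andbT.
have SK1 : 0 < #|S :&: K| by rewrite card_gt0; apply/set0Pn; exists s; rewrite inE sS.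
have [||P1 hP1] := IH K (S :&: K); first by [].
  split=> // [|Z sZK stZ]; first exact: subsetIr.
  by apply: leq_trans SK1; apply: stable_clique_card stZ cK sZK.
have [||P2 hP2] := IH (D :\: K) (S :&: (D :\: K)).
- rewrite cardsD (setIidPr sKD); have := subset_leq_card sKD.
  by move: K_n0; rewrite -card_gt0; lia.
- split=> // [|Z sZK stZ]; first exact: subsetIr.
  move: noZ; rewrite negb_exists => /forallP/(_ Z); rewrite sZK stZ /= -ltnNge S_K.
  by lia.
exists (P1 ++ P2); have -> : D = K :|: (D :\: K).
  apply/setP=> x; rewrite !inE; case xK: (x \in K); rewrite ?orbT ?andbT ?orbF //.
  by rewrite (subsetP sKD).
by apply: BE_partition_union => //; rewrite -setI_eq0 setIDA setDIl setDv set0I.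
Qed.

Lemma transitive_reduction D S c v p : maximum_stable_in D S -> BE_below D ->
    c \in D :\: S -> v \in D -> p \in D :\: S -> e c v -> e v p -> e c p ->
  exists P, BE_partition_of D S P.
Proof.
move=> maxS IH cDS vD pDS ecv evp ecp.
have ncv := arc_neq ecv; have nvp := arc_neq evp; have ncp := arc_neq ecp.
have nvc := ncv; have npv := nvp; have npc := ncp.
rewrite eq_sym in nvc; rewrite eq_sym in npv; rewrite eq_sym in npc.
have del x : x \in D :\: S -> exists P, BE_partition_of (D :\ x) S P.
  move=> xDS; apply: IH (maximum_stable_setD1 xDS maxS).
  by have /setDP[xD _] := xDS; rewrite [X in _ < X](cardsD1 x D) xD.
have /setDP[cD cS] := cDS; have /setDP[pD pS] := pDS.
have [evc|nevc] := boolP (e v c).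
  have [P hP] := del c cDS; apply: (insert_before cDS pDS ecp _ hP) => z zD nzc ezp.
  have [->//|nzv] := eqVneq z v; have nzp := arc_neq ezp.
  (* z -> p <- c -> v gives v -> z, and then c -> p <- v -> z gives z -> c. *)
  have evz : e v z by apply: (anti_P4_closed (a := z) (b := p) (c := c)); rewrite // eq_sym.
  by apply: (anti_P4_closed (a := c) (b := p) (c := v)); rewrite // eq_sym.
have [epv|nepv] := boolP (e p v).
  have [P hP] := del p pDS; apply: (insert_after cDS pDS ecp _ hP) => z zD nzp ecz.
  have [->//|nzv] := eqVneq z v; have nzc := arc_neq ecz.
  have ezv : e z v by apply: (anti_P4_closed (a := v) (b := p) (c := c)); rewrite // eq_sym.
  by apply: (anti_P4_closed (a := z) (b := v) (c := c)); rewrite // eq_sym.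
have epc : e p c by move: (noTT3 ecv evp ecp); rewrite (negPf nevc) (negPf nepv).
pose inD K := (K \subset D) && clique K.
have [|K /maxsetP[/andP[sKD cK] maxK] /subsetP sK] := @maxset_exists T inD [set c; v; p].
  apply/andP; split; first by apply/subsetP=> x; rewrite !inE -orbA => /or3P[] /eqP->.
  apply/cliqueP=> x y; rewrite !inE -!orbA => /or3P[] /eqP-> /or3P[] /eqP->;
  by rewrite ?eqxx // ?adjacentE ?ecv ?evp ?ecp ?epc ?orbT.
have [cin vin pin] : [/\ c \in K, v \in K & p \in K].
  by split; apply: sK; rewrite !inE eqxx ?orbT.
have [KD|nKD] := eqVneq K D.
  have [P hP] := del c cDS; apply: (insert_universal cDS pDS ecp epc _ hP) => z zD nzc.
  by apply: (cliqueP _ cK c z); rewrite // ?KD // eq_sym.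
have prK : K \proper D by rewrite properEneq nKD.
have [|//|[Z [sZ stZ leSZ]]] := clique_reduction maxS IH cK prK.
  by apply/set0Pn; exists c.
have [_ _ maxZ] := maxS.
have dZK : [disjoint Z & K].
  by apply/pred0P=> x /=; case xZ: (x \in Z) => //=; have := subsetP sZ x xZ;
    rewrite inE => /andP[/negPf].
(* A vertex of [K] without neighbours in [Z] would extend [Z] beyond the size of [S]; a vertex of
   [Z] adjacent to all of [K] would enlarge the maximal clique [K]. *)
case: (@no_escaping_stable_set Z K c v p) => // [x xK|z zZ].
  apply/exists_inP; apply: contraT; rewrite negb_exists_in => /forall_inP hx.
  have xZ : x \notin Z by rewrite (disjointFl dZK).
  have /maxZ : x |: Z \subset D.
    rewrite subUset sub1set (subsetP sKD) //=.
    by apply: subset_trans sZ (subsetDl _ _).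
  by move/(_ (stable_setU1 stZ hx)); rewrite cardsU1 xZ add1n ltnNge leSZ.
apply/exists_inP; apply: contraT; rewrite negb_exists_in => /forall_inP hz.
have zK : z \notin K by rewrite (disjointFr dZK).
have /setDP[zD _] := subsetP sZ z zZ.
case/negP: zK; rewrite -(maxK (z |: K)) ?setU11 ?subsetUr //.
rewrite /inD subUset sub1set zD sKD /=; apply/cliqueP=> x y.
have hz' k : k \in K -> adjacent e k z by move/hz; rewrite negbK.
move=> /setU1P[->|xK] /setU1P[->|yK] nxy.
- by rewrite eqxx in nxy.
- by rewrite adjacentC hz'.
- exact: hz'.
- by apply: (cliqueP _ cK).
Qed.

(** * Induction on the vertex set, and the theorem *)

Lemma BE_partition_exists D S :
  maximum_stable_in D S -> exists P, BE_partition_of D S P.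
Proof.
have [n] := ubnP #|D|; elim: n D S => // n IHn D S ltDn maxS.
have IH : BE_below D by move=> D' S' ltD'; apply: IHn; lia.
have [/exists_inP[c cDS /exists_inP[v vD /exists_inP[p pDS /and3P[cv vp cp]]]]|noT] :=
    boolP [exists c in D :\: S, exists v in D, exists p in D :\: S,
           [&& e c v, e v p & e c p]].
  exact: transitive_reduction cv vp cp.
apply: (BE_partition_of_transitive_free maxS) => c v p cDS vD pDS cv vp.
apply: contra noT => cp; apply/exists_inP; exists c => //.
by apply/exists_inP; exists v => //; apply/exists_inP; exists p => //; apply/and3P.
Qed.

Lemma BE_property_holds : BE_property e.
Proof.
move=> S [stS maxS].
have [|P [BE uP fP]] := @BE_partition_exists [set: T] S.
  by split=> // Z _; apply: maxS.
have uniqP r : r \in P -> uniq r.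
  case/path.splitPr def_P: P / => [P1 P2]; move: uP.
  by rewrite def_P flatten_cat /= !cat_uniq => /and3P[_ _ /andP[]].
have cardP r : r \in P -> #|[set x in S | x \in r]| = 1.
  move=> rP; have -> : #|[set x in S | x \in r]| = size (filter (mem S) r).
    rewrite cardE; apply/perm_size/uniq_perm; rewrite ?enum_uniq ?filter_uniq ?uniqP //.
    by move=> x; rewrite mem_enum inE mem_filter.
  by rewrite size_filter; have := allP BE r rP; case: (r) => // x q /and3P[_ /eqP].
exists P; split=> //; first split=> //.
- apply/allP=> r rP; have := allP BE r rP; have := uniqP r rP.
  by case: r {rP} => // x q u /and3P[pr _ _]; rewrite /dipath pr.
- by move=> x; rewrite fP inE.
move=> r x rP xS xr; have /eqP/cards1P[s def_s] := cardP r rP.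
have onlys z : z \in S -> z \in r -> z = s.
  by move=> zS zr; apply/set1P; rewrite -def_s inE zS.
rewrite (onlys x xS xr); have := allP BE r rP.
case: r {cardP def_s} rP xr onlys => // y q _ _ onlys /and3P[_ _ /orP[yS|lS]].
  by left; rewrite /= (onlys y) ?mem_head.
by right; rewrite /= (onlys (last y q)) ?mem_last.
Qed.

End Digraphs.

(** With all three reverse arcs missing, [x] is a source and [z] a sink of the triangle, which is
    then an induced blocking odd cycle with k = 1. *)
Lemma no_transitive_triangle (T : finType) (e : rel T) : irreflexive e ->
    (forall A : {set T}, ~ blocking_odd_cycle (@induced T e A)) ->
  forall x y z, e x y -> e y z -> e x z -> [|| e y x, e z y | e z x].
Proof.
move=> e_irr noboc x y z exy eyz exz; apply: contraT.
rewrite !negb_or => /and3P[nyx nzy nzx].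
(* The cycle is enumerated as x, z, y because the sink has to follow the source directly. *)
pose A := [set x; y; z]; pose s := [:: x; z; y].
have sA (i : 'I_3) : nth x s i \in A.
  by case: i => [[|[|[|i]]] //= ilt]; rewrite !inE eqxx ?orbT.
have nxy := arc_neq e_irr exy; have nyz := arc_neq e_irr eyz.
have nxz := arc_neq e_irr exz.
have us : uniq s by rewrite /= !inE negb_or nxz nxy eq_sym nyz.
pose X (i : 'I_3) : {x | x \in A} := Sub (nth x s i) (sA i).
case: (noboc A); exists 1, X; split=> //.
- apply: inj_card_bij => [i j /(congr1 val)/eqP|].
    by rewrite /= nth_uniq // => /eqP/val_inj.
  by rewrite card_sig card_ord (eq_card (B := mem s)) ?(card_uniqP us) // => u;
    rewrite !inE orbAC orbA.
- by case=> [[|[|[|i]]] ilt] //; case=> [[|[|[|j]]] jlt] //;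
    rewrite adjacentE /induced /= ?e_irr ?exy ?eyz ?exz ?orbT.
- move=> [u uA]; rewrite /induced /=; move: uA; rewrite !inE -orbA => /or3P[] /eqP->;
  by rewrite ?e_irr ?nyx ?nzx.
- move=> [u uA]; rewrite /induced /=; move: uA; rewrite !inE -orbA => /or3P[] /eqP->;
  by rewrite ?e_irr ?nzx ?nzy.
Qed.

Theorem theorem2 (T : finType) (e : rel T) (e_irr : irreflexive e)
    (e_ac3 : anti_circulant3 e)
    (e_noboc : forall A : {set T}, ~ blocking_odd_cycle (@induced T e A)) :
  BE_diperfect e.
Proof.
move=> A; apply: BE_property_holds => [u|v1 v2 v3 v4|u v w].
- exact: e_irr.
- case/andP; rewrite -(map_inj_uniq val_inj) => u4 arcs.
  by apply: e_ac3; apply/andP; split; first exact: u4.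
- exact: (no_transitive_triangle e_irr e_noboc).
Qed.
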